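(* Let $p$ be a prime. Then $p$ is a Wieferich prime if and only if $2 \in S(\mathrm{C}_{p} \times \mathrm{C}_{p})$.
   Context: A Wieferich prime is a prime number $p$ such that $2^{p-1} \equiv 1 \pmod{p^{2}}$. $\mathrm{C}_{p}$ denotes the cyclic group of order $p$. For a finite group $G$, let $x_{g}$ be a variable for each $g \in G$. The group determinant of $G$ is $\Theta_{G}(x_{g}) := \det (x_{g h^{-1}})_{g, h \in G} \in \mathbb{Z}[x_{g}]$, and the set of integer group determinants of $G$ is $S(G) := \{ \Theta_{G}(a_{g}) \mid a_{g} \in \mathbb{Z} \text{ for all } g \in G \}$. *)

(* Defs.v *)
From HB Require Import structures.
From mathcomp Require Import all_boot all_order all_algebra all_fingroup.
From mathcomp Require Import mpoly.

Set Implicit Arguments.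
Unset Strict Implicit.
Unset Printing Implicit Defensive.

Import GRing.Theory.

Local Open Scope ring_scope.

Definition wieferich (p : nat) : bool :=
  prime p && (2 ^ p.-1 == 1 %[mod p ^ 2])%N.

(* The group ['Z_p] is additive, so its [%g] product is addition mod p; it is
   the cyclic group of order p only for p > 1. *)
Definition cyclic_group (p : nat) : finGroupType := 'Z_p.

(* The variable x_g of Z[x_g | g in G] is indexed by the rank of g in the
   canonical enumeration of G, which also orders the matrix below. *)
Definition group_var (G : finGroupType) (g : G) : {mpoly int[#|G|]} :=
  'X_(enum_rank g).

Definition group_det (G : finGroupType) : {mpoly int[#|G|]} :=
  \det (\matrix_(i < #|G|, j < #|G|)
          group_var (enum_val i * (enum_val j)^-1)%g).

Definition group_det_at (G : finGroupType) (a : G -> int) : int :=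
  (group_det G).@[fun i => a (enum_val i)].

Definition int_group_dets (G : finGroupType) (n : int) : Prop :=
  exists a : G -> int, n = group_det_at a.

(* Main.v *)
Require Import Defs.
From HB Require Import structures.
From mathcomp Require Import all_boot all_order all_algebra all_fingroup.
From mathcomp Require Import all_field.
From mathcomp Require Import mpoly ring zify.

Set Implicit Arguments.
Unset Strict Implicit.
Unset Printing Implicit Defensive.

Import GRing.Theory.

Local Open Scope ring_scope.

(** Write G for C_p x C_p and M_a for the matrix (a(g h^-1)), so that a group
determinant is D = det M_a; the matrices M_a multiply like the elements of the
integral group ring of G.

Suppose D = 2. As G is commutative of exponent p, the Frobenius congruence in
the group ring gives M_a^p = c + p M_b with c = sum_g a(g)^p
([group_mx_exp_prime]), hence D^p = det (c + p M_b). Expand this in powers of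
p: the linear term is p c^(n-1) tr M_b with n = p^2, and tr M_b is a multiple
of |G| = p^2. The quadratic coefficient e satisfies
2 c^n e = c^(2n-2) (tr(M_b)^2 - tr(M_b^2)), so that p divides it when p is odd
and does not divide c. Therefore D^p = c^(p^2) modulo p^3
([det_pencil_mod_cube], [group_det_exp_prime]). For D = 2 this reads
2^p = c^(p^2) modulo p^3. By Fermat c = 2 modulo p, whence c^(p^2) = 2^(p^2)
modulo p^3, that is (2^(p-1))^p = 1 modulo p^3, and taking a p-th root loses
just one factor p ([wieferich_of_power]). The cases p = 2 and p dividing c are
excluded by size and parity.

Conversely let 2^p - 2 = p^2 t, and let x, y generate G, with
N_x = 1 + x + ... + x^(p-1) and N_y likewise. The group determinant of
F = 1 + x + g(y) N_x, where p g(y) = (1 + y)^p - 1 - y^p - t p N_y, is 2. Over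
the complex numbers D is the product of the values of F at all characters
([det_group_mx_characters]). With z a primitive p-th root of unity, the
characters with x |-> z^k, k nonzero, contribute 1 + z^k, and these multiply
to 1. The characters with x |-> 1, y |-> z^l contribute
(1 + z^l)^p, which again multiply to 1 over l nonzero, except that for l = 0
the value is 2^p - t p^2 = 2. *)

(** * Determinants of matrix pencils *)

Definition det_pencil (R : comNzRingType) (n : nat) (c : R) (M : 'M[R]_n) :=
  \det (c%:P%:M + 'X *: map_mx polyC M).

Lemma det_pencil_horner (R : comNzRingType) n (c : R) (M : 'M[R]_n) x :
  (det_pencil c M).[x] = \det (c%:M + x *: M).
Proof.
rewrite /det_pencil -[_.[x]]/(horner_eval x _) -det_map_mx; congr (\det _).
apply/matrixP => i j; rewrite !mxE /= /horner_eval.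
by rewrite !hornerE hornerMn !hornerE.
Qed.

(** The factor [c] in the second identity avoids the exponent [size s - 1]. *)
Lemma coef01_prod_affine (R : comNzRingType) (I : Type) (s : seq I) (c : R)
    (m : I -> R) (q := \prod_(i <- s) (c%:P + 'X * (m i)%:P)) :
  (q`_0 = c ^+ size s) * (c * q`_1 = c ^+ size s * \sum_(i <- s) m i).
Proof.
rewrite {}/q; elim: s => [|i s [IH0 IH1]].
  by rewrite !big_nil !coef1 !mulr0.
rewrite !big_cons mulrDl -mulrA; split.
  by rewrite coefD coefCM coefXM addr0 IH0 exprS.
rewrite coefD coefCM coefXM /= coefCM IH0 mulrDr {}IH1 exprS.
by ring.
Qed.

(** In the Leibniz formula, a permutation other than the identity moves at least
two points, and each contributes a factor ['X]; so up to degree 1 the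
determinant is the product of the diagonal entries. *)
Lemma coef01_det_pencil (R : comNzRingType) n (c : R) (M : 'M[R]_n)
    (q := det_pencil c M) :
  (q`_0 = c ^+ n) * (c * q`_1 = c ^+ n * \tr M).
Proof.
pose d := \prod_(i <- enum 'I_n) (c%:P + 'X * (M i i)%:P).
have [r qE] : exists r, q = d + 'X^2 * r.
  rewrite /q /det_pencil /determinant (bigD1 1%g) //= odd_perm1 mul1r.
  have -> : \prod_i (c%:P%:M + 'X *: map_mx polyC M) i ((1%g : 'S_n) i) = d.
    rewrite /d big_enum; apply: eq_bigr => i _.
    by rewrite perm1 !mxE eqxx mulr1n.
  elim/big_ind: _ => [|x y [r1 E1] [r2 E2]|s s_neq1].
  - by exists 0; rewrite mulr0 addr0.
  - have -> : d + (x + y) = d + x + (d + y) - d by ring.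
    by rewrite E1 E2; exists (r1 + r2); ring.
  have [i si_neq] : exists i, s i != i.
    apply/existsP; rewrite -negb_forall; apply: contra s_neq1 => /forallP s_id.
    by apply/eqP/permP => i; rewrite perm1; apply/eqP.
  rewrite (bigD1 i) //= (bigD1 (s i)) //= !mxE.
  rewrite (inj_eq perm_inj) ![_ == s _]eq_sym (negPf si_neq) !mulr0n !add0r.
  rewrite -!mulrA; move: ((-1) ^+ s) (\prod_(_ | _) _).
  move: (M i _)%:P (M (s i) _)%:P.
  by move=> x y e t; exists (e * x * y * t); rewrite expr2; ring.
have [d0 d1] := coef01_prod_affine (enum 'I_n) c (fun i => M i i).
rewrite qE !coefD !coefXnM /= !addr0 d0 d1 big_enum.
by rewrite -cardE card_ord.
Qed.

Lemma coef_comp_polyNX (R : comNzRingType) (q : {poly R}) i :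
  (q \Po (- 'X))`_i = (-1) ^+ i * q`_i.
Proof.
rewrite coef_comp_poly.
under eq_bigr => j _ do rewrite -scaleN1r exprZn coefZ coefXn mulrCA.
case: (ltnP i (size q)) => [lt_i|le_i].
  rewrite (bigD1 (Ordinal lt_i)) //= eqxx mulr1 big1 ?addr0 // => j ne_j.
  suff /negPf-> : i != j :> nat by rewrite !mulr0.
  by apply: contraNneq ne_j => ij_eq; apply/eqP/val_inj.
rewrite nth_default // mulr0 big1 // => j _.
by rewrite gtn_eqF ?mulr0 // (leq_trans (ltn_ord j)).
Qed.

Lemma det_pencilN (R : comNzRingType) n (c : R) (M : 'M[R]_n) :
  det_pencil c (- M) = det_pencil c M \Po (- 'X).
Proof.
rewrite /det_pencil -(det_map_mx (comp_poly (- 'X))); congr (\det _).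
apply/matrixP => i j; rewrite !mxE rmorphD rmorphMn rmorphM /=.
by rewrite !comp_polyC comp_polyX polyCN mulNr mulrN.
Qed.

(** The product of [c + tM] and [c - tM] is a pencil in [t^2]. This gives access
to the quadratic coefficient of [det (c + tM)] through first-order terms. *)
Lemma det_pencil_mulN (R : comNzRingType) n (c : R) (M : 'M[R]_n) :
  det_pencil c M * det_pencil c (- M) =
  det_pencil (c ^+ 2) (- (M *m M)) \Po 'X^2.
Proof.
rewrite /det_pencil -(det_map_mx (comp_poly 'X^2)) -det_mulmx; congr (\det _).
have map_compC (N : 'M[R]_n) : map_mx (comp_poly 'X^2) (map_mx polyC N) =
    map_mx polyC N.
  by apply/matrixP => i j; rewrite !mxE comp_polyC.
rewrite map_mxD map_mxZ map_compC map_scalar_mx /= comp_polyC comp_polyX.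
rewrite !map_mxN map_mxM /= !scalerN.
rewrite mulmxDl !mulmxDr !mulmxN -scalar_mxM -rmorphM.
rewrite -!scalemxAl -!scalemxAr scalerA -!expr2.
by rewrite addrA; congr (_ - _); rewrite -scalar_mxC subrK.
Qed.

Lemma horner_mod_cube (R : comNzRingType) (q : {poly R}) x :
  exists r, q.[x] = q`_0 + q`_1 * x + q`_2 * x ^+ 2 + x ^+ 3 * r.
Proof.
exists (drop_poly 3 q).[x].
rewrite -{1}(poly_take_drop 3 q) hornerD hornerM hornerXn mulrC.
congr (_ + _); rewrite horner_poly.
by rewrite !big_ord_recr big_ord0 /= add0r expr0 mulr1 expr1.
Qed.

(** The linear coefficient is a multiple of [p^2] because of the trace of [M].
Comparing the terms of degree 2 in [det_pencil_mulN] expresses [2 c^n] times the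
quadratic coefficient through the square of the linear one and the trace of
[M^2]; the factor 2 is why [p] has to be odd. *)
Lemma det_pencil_mod_cube n (c : int) (M : 'M[int]_n) (p : nat) :
    odd p -> prime p -> ~~ (p %| c)%Z -> (p%:Z ^+ 2 %| \tr M)%Z ->
    (p %| \tr (M *m M))%Z ->
  (\det (c%:M + p%:Z *: M) == c ^+ n %[mod p%:Z ^+ 3])%Z.
Proof.
move=> p_odd p_prime p_ndiv_c trM trM2.
have p_ndiv_cX k : coprimez p (c ^+ k).
  by rewrite coprimezXr // coprimezE prime_coprime.
have p_ndiv_2 : coprimez p 2 by rewrite coprimezE coprime_sym coprime2n.
rewrite -det_pencil_horner.
have [r ->] := horner_mod_cube (det_pencil c M) p%:Z.
set q := det_pencil c M.
have [q0 q1] := coef01_det_pencil c M; rewrite -/q in q0 q1.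
have dvd_q1 : (p%:Z ^+ 2 %| q`_1)%Z.
  rewrite -(Gauss_dvdzr _ (coprimezXl 2 (p_ndiv_cX 1%N))) expr1 q1.
  by rewrite dvdz_mull.
have [_] := coef01_det_pencil (c ^+ 2) (- (M *m M)).
set q' := det_pencil (c ^+ 2) _ => q'1.
have dvd_q'1 : (p %| q'`_1)%Z.
  rewrite -(Gauss_dvdzr _ (p_ndiv_cX 2%N)) q'1.
  by rewrite raddfN dvdz_mull // rpredN.
have dvd_q2 : (p %| q`_2)%Z.
  have := congr1 (fun f : {poly _} => f`_2) (det_pencil_mulN c M).
  rewrite det_pencilN -/q -/q' coef_comp_poly_Xn //= coefM.
  rewrite !big_ord_recr big_ord0 /= !coef_comp_polyNX q0 => q2E.
  rewrite -(Gauss_dvdzr _ p_ndiv_2) -(Gauss_dvdzr _ (p_ndiv_cX n)).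
  have [u uE] := dvdzP dvd_q1; have [v vE] := dvdzP dvd_q'1.
  apply/dvdzP; exists (v + p%:Z ^+ 3 * u ^+ 2).
  move: q2E; rewrite uE vE; move: (c ^+ n) q`_2 => a b /eqP.
  rewrite -subr_eq0 => /eqP q2E; apply/eqP; rewrite -subr_eq0 -q2E.
  by apply/eqP; ring.
rewrite eqz_mod_dvd q0.
have [u ->] := dvdzP dvd_q1; have [v ->] := dvdzP dvd_q2.
apply/dvdzP; exists (u + v + r); ring.
Qed.

(** * Congruences between prime powers *)

Lemma expr1D_mod_cube (R : comNzRingType) (t : R) n :
  exists r, (1 + t) ^+ n = 1 + t *+ n + t ^+ 2 *+ 'C(n, 2) + t ^+ 3 * r.
Proof.
elim: n => [|n [r IH]]; first by exists 0; rewrite !mulr0n mulr0 !addr0.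
exists (r + t * r + 'C(n, 2)%:R).
rewrite exprSr IH binS bin1 mulrSr mulrnDr -[t *+ n]mulr_natr.
rewrite -[t ^+ 2 *+ n]mulr_natr -[_ *+ 'C(n, 2)]mulr_natr.
move: n%:R 'C(n, 2)%:R => a b; ring.
Qed.

Lemma fermat_int (p : nat) (x : int) : prime p -> (x ^+ p == x %[mod p])%Z.
Proof.
move=> p_prime; rewrite eqz_mod_dvd (dvdz_pcharf (pchar_Fp p_prime)).
rewrite rmorphB rmorphXn /= subr_eq0 -[in X in _ ^+ X](card_Fp p_prime).
by rewrite expf_card.
Qed.

(** [x^p - y^p] is [x - y] times a sum of [p] terms that are all congruent to
[y^(p-1)] modulo [p]. *)
Lemma eqz_mod_expp (p k : nat) (x y : int) : prime p -> (0 < k)%N ->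
  (x == y %[mod p%:Z ^+ k])%Z -> (x ^+ p == y ^+ p %[mod p%:Z ^+ k.+1])%Z.
Proof.
move=> p_prime k_gt0; rewrite !eqz_mod_dvd subrXX exprSr => dvd_xy.
apply: dvdz_mul => //; rewrite (dvdz_pcharf (pchar_Fp p_prime)).
have xyE : x%:~R = y%:~R :> 'F_p.
  apply/eqP; rewrite -subr_eq0 -rmorphB -(dvdz_pcharf (pchar_Fp p_prime)).
  by apply: dvdz_trans dvd_xy; rewrite -(prednK k_gt0) exprS dvdz_mulr.
rewrite rmorph_sum /= (eq_bigr (fun=> (y ^+ p.-1)%:~R)) => [|i _].
  by rewrite sumr_const card_ord -mulr_natl pchar_Fp_0 // mul0r.
rewrite rmorphM !rmorphXn /= xyE -exprD; congr (_ ^+ _).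
have := ltn_ord i; lia.
Qed.

(** By Fermat [c = 2] modulo [p], so [c^(p^2) = 2^(p^2)] modulo [p^3] and the
hypothesis becomes [(2^(p-1))^p = 1] modulo [p^3]. With [2^(p-1) = 1 + p u] the left-hand side is
[1 + p^2 u] modulo [p^3], as [p] divides the binomial coefficient of the
quadratic term; hence [p] divides [u]. *)
Lemma wieferich_of_power (p : nat) (c : int) : prime p -> odd p ->
  (2 ^+ p == (c ^+ p) ^+ p %[mod p%:Z ^+ 3])%Z ->
  (2 ^ p.-1 == 1 %[mod p ^ 2])%N.
Proof.
move=> p_prime p_odd pow_eq; have p_gt0 := prime_gt0 p_prime.
have p_neq0 : p%:Z != 0 by rewrite eqz_nat -lt0n.
have c_eq2 : (c == 2 %[mod p%:Z ^+ 1])%Z.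
  rewrite expr1 -(eqP (fermat_int c p_prime)).
  rewrite -(eqP (fermat_int (c ^+ p) p_prime)) -(eqP (fermat_int 2 p_prime)).
  rewrite eq_sym eqz_mod_dvd; apply: dvdz_trans (_ : p%:Z ^+ 3 %| _)%Z.
    by rewrite exprS dvdz_mulr.
  by rewrite -eqz_mod_dvd.
have {c_eq2} c_eq2 := eqz_mod_expp p_prime (ltn0Sn 0) c_eq2.
have {c_eq2} c_eq2 := eqz_mod_expp p_prime (ltn0Sn 1) c_eq2.
rewrite (eqP c_eq2) {c c_eq2} in pow_eq.
have [u uE] : exists u, 2 ^+ p.-1 = 1 + p%:Z * u.
  have := fermat_int 2 p_prime; rewrite -{1}(prednK p_gt0) exprS eqz_mod_dvd.
  have -> : 2 * 2 ^+ p.-1 - 2 = 2 * (2 ^+ p.-1 - 1) :> int by ring.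
  rewrite Gauss_dvdzr.
    by case/dvdzP => u uE; exists u; rewrite mulrC -uE; ring.
  by rewrite coprimezE coprime_sym coprime2n.
have : (p%:Z ^+ 3 %| (1 + p%:Z * u) ^+ p - 1)%Z.
  rewrite -(@Gauss_dvdzr _ (2 ^+ p)); last first.
    by rewrite coprimezXr // coprimezXl // coprimezE coprime_sym coprime2n.
  rewrite -uE mulrBr mulr1 -exprMn -exprS prednK //.
  by rewrite -eqz_mod_dvd eq_sym.
have [r ->] := expr1D_mod_cube (p%:Z * u) p.
have [v vE] : exists v, 'C(p, 2) = (v * p)%N.
  by apply/dvdnP/prime_dvd_bin => //=; apply: odd_prime_gt2.
have -> : 1 + p%:Z * u *+ p + (p%:Z * u) ^+ 2 *+ 'C(p, 2)
    + (p%:Z * u) ^+ 3 * r - 1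
   = p%:Z ^+ 2 * u + p%:Z ^+ 3 * (u ^+ 2 * v%:Z + u ^+ 3 * r).
  rewrite vE mulrnA -[p%:Z * u *+ p]mulr_natr.
  rewrite -[(_ *+ v) *+ p]mulr_natr -[_ *+ v]mulr_natr.
  by rewrite !natz; ring.
case/dvdzP => w wE.
have /dvdzP[{r w wE v vE} w wE] : (p %| u)%Z.
  rewrite -(@dvdz_mul2l (p%:Z ^+ 2)) ?expf_neq0 // -exprSr.
  apply/dvdzP; exists (w - (u ^+ 2 * v%:Z + u ^+ 3 * r)).
  by rewrite mulrBl -wE; ring.
have PoszX m k : Posz (m ^ k)%N = m%:Z ^+ k by rewrite -natz natrX natz.
rewrite -eqz_nat -!modz_nat !PoszX.
rewrite eqz_mod_dvd uE wE; apply/dvdzP; exists w; ring.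
Qed.

(** * Group matrices *)

Definition group_mx (R : pzRingType) (G : finGroupType) (a : G -> R) :
    'M[R]_#|G| :=
  \matrix_(i, j) a (enum_val i * (enum_val j)^-1)%g.

Lemma group_det_atE (G : finGroupType) (a : G -> int) :
  group_det_at a = \det (group_mx a).
Proof.
rewrite /group_det_at /group_det -det_map_mx; congr (\det _).
apply/matrixP => i j; rewrite !mxE /= /group_var mevalXU.
by rewrite enum_rankK.
Qed.

Lemma eq_group_mx (R : pzRingType) (G : finGroupType) (a b : G -> R) :
  a =1 b -> group_mx a = group_mx b.
Proof. by move=> eq_ab; apply/matrixP => i j; rewrite !mxE. Qed.

Lemma group_mxD (R : pzRingType) (G : finGroupType) (a b : G -> R) :
  group_mx a + group_mx b = group_mx (fun g => a g + b g).
Proof. by apply/matrixP => i j; rewrite !mxE. Qed.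

Lemma big_enum_val_type (R : Type) (idx : R) (op : Monoid.com_law idx)
    (T : finType) (F : T -> R) :
  \big[op/idx]_(i < #|T|) F (enum_val i) = \big[op/idx]_x F x.
Proof. by rewrite -(big_enum_val F). Qed.

Lemma group_mxM (R : pzRingType) (G : finGroupType) (a b : G -> R) :
  group_mx a *m group_mx b = group_mx (fun g => \sum_h a (g * h^-1)%g * b h).
Proof.
apply/matrixP => i j; rewrite !mxE.
under eq_bigr => k _ do rewrite !mxE.
set y := enum_val j; set x := enum_val i.
rewrite (big_enum_val_type _ (fun z => a (x * z^-1)%g * b (z * y^-1)%g)).
rewrite (reindex_inj (mulIg y)) /=; apply: eq_bigr => h _.
by rewrite mulgK invMg !mulgA.
Qed.

Lemma group_mx_scalar (R : pzRingType) (G : finGroupType) (c : R) :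
  group_mx (fun g : G => c *+ (g == 1%g)) = c%:M.
Proof.
apply/matrixP => i j; rewrite !mxE.
by rewrite -eq_mulgV1 (inj_eq enum_val_inj).
Qed.

Lemma tr_group_mx (R : pzRingType) (G : finGroupType) (a : G -> R) :
  \tr (group_mx a) = a 1%g *+ #|G|.
Proof.
rewrite /mxtrace (eq_bigr (fun=> a 1%g)) => [|i _]; last by rewrite mxE mulgV.
by rewrite sumr_const card_ord.
Qed.

Lemma group_mxX_closed (R : pzRingType) (G : finGroupType) (a : G -> R) n :
  exists b, group_mx a ^+ n = group_mx b.
Proof.
elim: n => [|n [b IH]].
  by exists (fun g => 1 *+ (g == 1%g)); rewrite group_mx_scalar.
by rewrite exprS IH; eexists; apply: group_mxM.
Qed.

Lemma group_mx_delta_exp (R : pzRingType) (G : finGroupType) (h : G) (c : R) n :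
  group_mx (fun g => c *+ (g == h)) ^+ n =
  group_mx (fun g => c ^+ n *+ (g == h ^+ n)%g).
Proof.
elim: n => [|n IH]; first by rewrite group_mx_scalar.
rewrite exprS {}IH [LHS]group_mxM; apply: eq_group_mx => g.
rewrite (bigD1 (h ^+ n)%g) //= big1 => [|k /negPf->]; last by rewrite mulr0.
rewrite addr0 eqxx mulr1n mulrnAl -exprS expgS.
by rewrite -(inj_eq (mulIg (h ^+ n)%g)) mulgKV.
Qed.

Lemma group_mx_comm (R : comPzRingType) (G : finGroupType) (a b : G -> R) :
  (forall x y : G, commute x y) ->
  group_mx a *m group_mx b = group_mx b *m group_mx a.
Proof.
move=> G_abelian; rewrite !group_mxM; apply: eq_group_mx => g.
rewrite (reindex_inj invg_inj) (reindex_inj (mulIg (g^-1)%g)) /=.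
apply: eq_bigr => h _; rewrite !invgK mulrC.
congr (b _ * a _); first by rewrite invMg invgK.
by rewrite (G_abelian g) mulgKV.
Qed.

(** The intermediate binomial coefficients are multiples of [p], and the
products of group matrices that they multiply are again group matrices. *)
Lemma group_mxD_exp_prime (G : finGroupType) (a b : G -> int) p :
    (forall x y : G, commute x y) -> prime p ->
  exists d, (group_mx a + group_mx b) ^+ p =
            group_mx a ^+ p + group_mx b ^+ p + p%:Z *: group_mx d.
Proof.
move=> G_abelian p_prime.
rewrite exprDn_comm; last exact: group_mx_comm.
case: p p_prime => // p p_prime.
rewrite big_ord_recl big_ord_recr /= subn0 expr0 mulr1 bin0 mulr1n.
rewrite /bump !add1n subnn expr0 mul1r binn mulr1n addrA addrAC.
set S := \sum_(_ < _) _.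
suff [d ->] : exists d, S = p.+1%:Z *: group_mx d by exists d.
rewrite /S; elim/big_ind: _ => [|_ _ [d ->] [e ->]|i _].
- by exists (fun=> 0); apply/matrixP => i j; rewrite !mxE mulr0.
- by exists (fun g => d g + e g); rewrite -scalerDr group_mxD.
rewrite leq0n !add1n.
have [d ->] := group_mxX_closed a (p.+1 - i.+1).
have [e ->] := group_mxX_closed b i.+1.
have /dvdnP[m ->] : (p.+1 %| 'C(p.+1, i.+1))%N.
  by rewrite prime_dvd_bin //= ltnS.
have [f ->] : exists f, group_mx d * group_mx e = group_mx f.
  by eexists; apply: group_mxM.
exists (fun g => f g *+ m); rewrite mulrnA -scaler_nat natz; congr (_ *: _).
by apply/matrixP => j k; rewrite mulmxnE !mxE.
Qed.

(** A group matrix is a sum of terms [a h *: P_h] with [P_h] the permutation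
matrix of [h], and [P_h ^+ p = 1]; the p-th power is additive modulo [p]. *)
Lemma group_mx_exp_prime (G : finGroupType) (a : G -> int) p :
    (forall x y : G, commute x y) -> (forall x : G, x ^+ p = 1)%g -> prime p ->
  exists c b, group_mx a ^+ p = c%:M + p%:Z *: group_mx b.
Proof.
move=> G_abelian G_exp p_prime.
have sumE : a =1 (fun g => \sum_(h : G) a h *+ (g == h)).
  move=> g; rewrite (bigD1 g) //= eqxx mulr1n big1 ?addr0 // => h.
  by rewrite eq_sym => /negPf->.
rewrite (eq_group_mx sumE); elim: (index_enum G) => [|h s [c [b IH]]].
  exists 0, (fun=> 0); rewrite raddf0 add0r.
  have -> : group_mx (fun g => \sum_(h <- [::]) a h *+ (g == h)) = 0.
    by apply/matrixP => i j; rewrite !mxE big_nil.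
  rewrite expr0n gtn_eqF ?prime_gt0 //.
  by apply/matrixP => i j; rewrite !mxE mulr0.
have -> : group_mx (fun g => \sum_(i <- h :: s) a i *+ (g == i)) =
    group_mx (fun g => a h *+ (g == h))
     + group_mx (fun g => \sum_(i <- s) a i *+ (g == i)).
  by rewrite group_mxD; apply: eq_group_mx => g; rewrite big_cons.
have [d ->] := group_mxD_exp_prime (fun g => a h *+ (g == h))
  (fun g => \sum_(i <- s) a i *+ (g == i)) G_abelian p_prime.
rewrite group_mx_delta_exp G_exp group_mx_scalar IH.
exists (a h ^+ p + c), (fun g => b g + d g).
by rewrite -group_mxD scalerDr raddfD /= !addrA.
Qed.

(** The second claim holds because, when [p] divides [c], the matrix [c + p M_b]
is [p] times an integer matrix of size [p^2]. *)
Lemma group_det_exp_prime (G : finGroupType) (a : G -> int) p :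
    (forall x y : G, commute x y) -> (forall x : G, x ^+ p = 1)%g -> prime p ->
    #|G| = (p ^ 2)%N ->
  exists c, [/\ (group_det_at a ^+ p == c ^+ (p ^ 2) %[mod p])%Z,
    ((p %| c)%Z -> (p%:Z ^+ (p ^ 2) %| group_det_at a ^+ p)%Z) &
    odd p -> ~~ (p %| c)%Z ->
      (group_det_at a ^+ p == c ^+ (p ^ 2) %[mod p%:Z ^+ 3])%Z].
Proof.
move=> G_abelian G_exp p_prime cardG.
have [c [b powE]] := group_mx_exp_prime a G_abelian G_exp p_prime.
exists c; rewrite group_det_atE.
have -> : \det (group_mx a) ^+ p = \det (c%:M + p%:Z *: group_mx b).
  rewrite -powE; elim: (p) => [|k IH]; first by rewrite !expr0 det1.
  by rewrite !exprS IH [RHS]det_mulmx.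
split.
- rewrite -det_pencil_horner.
  have [r ->] := horner_mod_cube (det_pencil c (group_mx b)) p%:Z.
  have [-> _] := coef01_det_pencil c (group_mx b).
  rewrite -cardG eqz_mod_dvd; set x := c ^+ _; apply/dvdzP.
  move: (_`_1) (_`_2) => y z; exists (y + z * p%:Z + p%:Z ^+ 2 * r); ring.
- case/dvdzP => k ->; rewrite mulrC -scale_scalar_mx -scalerDr detZ -cardG.
  exact: dvdz_mulr.
move=> p_odd p_ndiv_c; rewrite -cardG; apply: det_pencil_mod_cube => //.
  by rewrite tr_group_mx cardG -mulr_natr natrX natz dvdz_mull.
rewrite group_mxM tr_group_mx cardG -mulr_natr natrX natz expr2 mulrA.
exact: dvdz_mull.
Qed.

(** If [p] divided [c], then [p^(p^2)] would divide [2^p], which is too small.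
If [p = 2], the congruence modulo [2] forces [c] to be even, so this also
excludes [p = 2]. *)
Lemma wieferich_of_group_det (G : finGroupType) (a : G -> int) p :
    (forall x y : G, commute x y) -> (forall x : G, x ^+ p = 1)%g -> prime p ->
    #|G| = (p ^ 2)%N -> group_det_at a = 2 ->
  wieferich p.
Proof.
move=> G_abelian G_exp p_prime cardG.
have [c [D_modp D_dvd D_mod3]] :=
  group_det_exp_prime a G_abelian G_exp p_prime cardG.
move=> D_eq2; rewrite {}D_eq2 in D_modp D_dvd D_mod3.
have [p_ge2 p_gt0] := (prime_gt1 p_prime, prime_gt0 p_prime).
have p_ndiv_c : ~~ (p %| c)%Z.
  apply/negP => /D_dvd; rewrite dvdzE !abszX /= => /dvdn_leq.
  rewrite expn_gt0 => /(_ isT); apply/negP; rewrite -ltnNge.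
  apply: leq_trans (_ : 2 ^ (p ^ 2) <= _)%N; last first.
    by rewrite leq_exp2r ?expn_gt0 ?p_gt0.
  by rewrite ltn_exp2l // -mulnn ltn_Pmull.
have [p2|p_odd] := even_prime p_prime.
  move: D_modp p_ndiv_c; rewrite p2 => D_modp; case/negP.
  have : (c ^+ (2 ^ 2) == 0 %[mod 2])%Z by rewrite -(eqP D_modp).
  by rewrite eqz_mod_dvd subr0 dvdzE abszX Euclid_dvdX // => /andP[].
rewrite /wieferich p_prime; apply: (@wieferich_of_power _ c) => //.
by rewrite -exprM mulnn; apply: D_mod3.
Qed.

(** * Diagonalization by characters *)

(** The rows of the character table [W] are left eigenvectors of the group
matrix, and the orthogonality relation makes [W] invertible. *)
Lemma det_group_mx_characters (F : idomainType) (G : finGroupType)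
    (chi : G -> G -> F) (a : G -> F) :
    (forall k, chi k 1%g = 1) ->
    (forall k g h, chi k (g * h)%g = chi k g * chi k h) ->
    (forall g, g != 1%g -> \sum_k chi k g = 0) -> #|G|%:R != 0 :> F ->
  \det (group_mx a) = \prod_k \sum_g a g * chi k g.
Proof.
move=> chi1 chiM chi_orth cardG_neq0.
pose W := \matrix_(i < #|G|, j < #|G|) chi (enum_val i) (enum_val j).
pose W' := \matrix_(i < #|G|, j < #|G|) chi (enum_val j) (enum_val i)^-1%g.
pose ahat := \row_(i < #|G|) (\sum_g a g * chi (enum_val i) g).
have W_eigen : W *m group_mx a = diag_mx ahat *m W.
  apply/matrixP => i j; rewrite mul_diag_mx !mxE.
  under eq_bigr => k _ do rewrite !mxE.
  rewrite (big_enum_val_type _ (fun g => chi _ g * a (g * (enum_val j)^-1)%g)).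
  rewrite (reindex_inj (mulIg (enum_val j))) mulr_suml /=.
  by apply: eq_bigr => g _; rewrite mulgK chiM; ring.
have W'W : W' *m W = #|G|%:R%:M.
  apply/matrixP => i j; rewrite !mxE.
  under eq_bigr => k _ do rewrite !mxE -chiM.
  rewrite (big_enum_val_type _ (fun g => chi g _)) /=.
  have [->|ij_neq] := eqVneq i j; last first.
    by rewrite chi_orth // -eq_mulVg1 (inj_eq enum_val_inj).
  by rewrite mulVg (eq_bigr (fun=> 1)) ?sumr_const.
have detW_neq0 : \det W != 0.
  apply: contraNneq cardG_neq0 => detW0.
  have := congr1 determinant W'W.
  rewrite det_mulmx detW0 mulr0 det_scalar => /esym/eqP.
  by rewrite expf_eq0 => /andP[].
apply: (mulfI detW_neq0); rewrite -det_mulmx W_eigen det_mulmx mulrC.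
congr (_ * _); rewrite det_diag.
rewrite -(big_enum_val_type _ (fun k => \sum_g a g * chi k g)).
by apply: eq_bigr => i _; rewrite mxE.
Qed.

Lemma sum_unity_root (F : idomainType) p (w : F) :
  w ^+ p = 1 -> \sum_(i < p) w ^+ i = (w == 1)%:R * p%:R.
Proof.
move=> wp1; case: eqVneq => [->|w_neq1].
  rewrite (eq_bigr (fun=> 1)) => [|i _]; last by rewrite expr1n.
  by rewrite sumr_const card_ord mul1r.
have := subrX1 w p; rewrite wp1 subrr => /esym/eqP.
by rewrite mulf_eq0 subr_eq0 (negPf w_neq1) mul0r => /eqP.
Qed.

(** Evaluate [\prod_i ('X - z^i) = 'X^p - 1] at [-1]. *)
Lemma prod1D_prim_root (F : fieldType) p (z : F) :
  odd p -> p.-primitive_root z -> \prod_(i < p) (1 + z ^+ i) = 2.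
Proof.
move=> p_odd z_prim.
have := congr1 (fun f : {poly F} => f.[-1]) (factor_Xn_sub_1 z_prim).
rewrite horner_prod big_mkord !hornerE -signr_odd p_odd expr1.
rewrite (eq_bigr (fun i : 'I_p => - (1 + z ^+ i))) => [|i _]; last first.
  by rewrite !hornerE; ring.
rewrite prodrN card_ord -signr_odd p_odd expr1 mulN1r => /eqP.
by rewrite -opprD eqr_opp => /eqP ->.
Qed.

Lemma sum_prim_root_Zp (F : idomainType) p (z : F) (k : 'Z_p) :
    (1 < p)%N -> p.-primitive_root z ->
  \sum_(i : 'Z_p) z ^+ (i * k) = (k == 0)%:R * p%:R.
Proof.
move=> p_gt1 p_prim.
have z_prim : (Zp_trunc p).+2.-primitive_root z by rewrite Zp_cast.
have -> : p%:R = (Zp_trunc p).+2%:R :> F by rewrite Zp_cast.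
under eq_bigr => i _ do rewrite mulnC exprM.
rewrite sum_unity_root; last by rewrite exprAC (prim_expr_order z_prim) expr1n.
by rewrite -(prim_order_dvd z_prim) /dvdn modn_small.
Qed.

Definition Zp2_char (F : pzRingType) p (z : F) (k g : 'Z_p * 'Z_p) : F :=
  z ^+ (k.1 * g.1 + k.2 * g.2).

Lemma Zp2_charM (F : idomainType) p (z : F)
    (k g h : cyclic_group p * cyclic_group p) :
    (1 < p)%N -> p.-primitive_root z ->
  Zp2_char z k (g * h)%g = Zp2_char z k g * Zp2_char z k h.
Proof.
move=> p_gt1 p_prim.
have z_prim : (Zp_trunc p).+2.-primitive_root z by rewrite Zp_cast.
rewrite /Zp2_char -exprD -(prim_expr_mod z_prim) -[RHS](prim_expr_mod z_prim).
congr (_ ^+ _); rewrite /= addnACA -!mulnDr.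
by rewrite -[LHS]modnDm !modnMmr modnDm.
Qed.

Lemma sum_pair_mul (R : pzRingType) (S T : finType) (f : S -> R) (g : T -> R) :
  \sum_(h : S * T) f h.1 * g h.2 = (\sum_i f i) * (\sum_j g j).
Proof. by rewrite big_distrlr /= pair_big. Qed.

Lemma sum_Zp2_char (F : idomainType) p (z : F)
    (g : cyclic_group p * cyclic_group p) :
    (1 < p)%N -> p.-primitive_root z -> g != 1%g ->
  \sum_(k : (cyclic_group p * cyclic_group p)%type) Zp2_char z k g = 0.
Proof.
move=> p_gt1 z_prim; case: g => g1 g2 g_neq1.
under eq_bigr => k _ do rewrite /Zp2_char exprD /=.
rewrite (sum_pair_mul (fun i : 'Z_p => z ^+ (i * g1))
  (fun i : 'Z_p => z ^+ (i * g2))).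
rewrite !sum_prim_root_Zp //.
have [g1_0|] := eqVneq g1 0; last by rewrite !mul0r.
have [g2_0|] := eqVneq g2 0; last by rewrite mul0r mulr0.
by rewrite g1_0 g2_0 eqxx in g_neq1.
Qed.

Lemma det_group_mx_Zp2 (F : fieldType) p (z : F)
    (a : (cyclic_group p * cyclic_group p)%type -> F) :
    (1 < p)%N -> p.-primitive_root z ->
  \det (group_mx a) = \prod_(k : 'Z_p) \prod_(l : 'Z_p)
     \sum_(i : 'Z_p) \sum_(j : 'Z_p) a (i, j) * z ^+ (k * i + l * j).
Proof.
move=> p_gt1 z_prim.
rewrite (@det_group_mx_characters _ _ (@Zp2_char F p z)).
- rewrite pair_big /=; apply: eq_bigr => k _; rewrite pair_big /=.
  by apply: eq_bigr => -[i j] _.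
- by move=> k; rewrite /Zp2_char /= !muln0.
- by move=> k g h; apply: Zp2_charM.
- by move=> g; apply: sum_Zp2_char.
rewrite card_prod card_ord Zp_cast // natrM.
by rewrite mulf_neq0 // (prim_root_natf_neq0 z_prim).
Qed.

(** * An element of determinant 2 *)

Lemma big_Zp (R : Type) (idx : R) (op : Monoid.law idx) p (F : nat -> R) :
  (1 < p)%N -> \big[op/idx]_(i : 'Z_p) F i = \big[op/idx]_(i < p) F i.
Proof. by move=> p_gt1; rewrite -!(big_mkord xpredT) /= Zp_cast. Qed.

Lemma prod1D_prim_root_neq0 (F : fieldType) p (z : F) :
    2 != 0 :> F -> odd p -> (1 < p)%N -> p.-primitive_root z ->
  \prod_(k : 'Z_p | k != 0) (1 + z ^+ k) = 1.
Proof.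
move=> two_neq0 p_odd p_gt1 z_prim.
have := prod1D_prim_root p_odd z_prim.
rewrite -(big_Zp _ (fun k => 1 + z ^+ k) p_gt1) (bigD1 0) //= expr0.
by move=> prod_eq2; apply: (mulfI two_neq0); rewrite mulr1.
Qed.

(** The coefficient of [y^j] in
[((1 + y)^p - 1 - y^p) / p - t (1 + y + ... + y^(p-1))]. *)
Definition wieferich_coef (p : nat) (t : int) (j : 'Z_p) : int :=
  (if j == 0 then 0 else ('C(p, j) %/ p)%N%:Z) - t.

(** This is the value of the element of determinant 2 at the character that is
trivial on [x] and sends [y] to [z^l]. *)
Lemma sum_wieferich_coef (F : fieldType) p t (z : F) (l : 'Z_p) :
    prime p -> p.-primitive_root z ->
  2 + p%:R * \sum_(j : 'Z_p) (wieferich_coef t j)%:~R * z ^+ (l * j) =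
  (1 + z ^+ l) ^+ p - (l == 0)%:R * (p%:Z ^+ 2 * t)%:~R.
Proof.
move=> p_prime z_prim; have p_gt1 := prime_gt1 p_prime.
pose w := z ^+ l.
have wp1 : w ^+ p = 1 by rewrite exprAC (prim_expr_order z_prim) expr1n.
have coefE (j : 'Z_p) : p%:R * (wieferich_coef t j)%:~R =
    'C(p, j)%:R - (j == 0)%:R - (p%:Z * t)%:~R :> F.
  rewrite /wieferich_coef rmorphB rmorphM mulrBr /=; congr (_ - _).
  have [->|j_neq0] := eqVneq j 0; first by rewrite bin0 subrr mulr0.
  rewrite subr0 -[_%:~R]pmulrn -natrM mulnC divnK // prime_dvd_bin //.
  apply/andP; split; last by rewrite -[X in (_ < X)%N](Zp_cast p_gt1).
  by rewrite lt0n; apply: contraNneq j_neq0 => j0; apply/eqP/val_inj.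
rewrite mulr_sumr; under eq_bigr => j _ do
  rewrite mulrA coefE !mulrBl exprM -/w.
rewrite !sumrB -mulr_sumr (big_Zp _ (fun i => w ^+ i)) //.
rewrite (big_Zp _ (fun i => 'C(p, i)%:R * w ^+ i)) //.
have -> : \sum_(i < p) w ^+ i = (l == 0)%:R * p%:R.
  rewrite -(big_Zp _ (fun i => w ^+ i)) // -(sum_prim_root_Zp _ p_gt1 z_prim).
  by apply: eq_bigr => i _; rewrite mulnC exprM.
have -> : \sum_(j : 'Z_p) (j == 0)%:R * w ^+ j = 1.
  rewrite (bigD1 0) //= big1 => [|j /negPf->]; last by rewrite mul0r.
  by rewrite mul1r addr0.
have -> : (1 + w) ^+ p = \sum_(j < p) 'C(p, j)%:R * w ^+ j + 1.
  rewrite exprDn big_ord_recr /= subnn expr0 mul1r binn wp1; congr (_ + _).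
  by apply: eq_bigr => j _; rewrite expr1n mul1r mulr_natl.
rewrite !rmorphM /=.
by move: (\sum_(_ < _) _) => S; rewrite -[p%:~R]pmulrn; ring.
Qed.

(** The function [a] below is the element [1 + x + g(y) (1 + x + ... + x^(p-1))]
of the group ring, where [g] has the coefficients [wieferich_coef t] and
[t = (2^p - 2) / p^2]. *)
Lemma wieferich_two_group_det p : wieferich p ->
  exists a : (cyclic_group p * cyclic_group p)%type -> int, group_det_at a = 2.
Proof.
case/andP => p_prime p_wief.
have [p_gt1 p_gt0] := (prime_gt1 p_prime, prime_gt0 p_prime).
have p_odd : odd p.
  by have [p2|//] := even_prime p_prime; rewrite p2 in p_wief.
have [t tE] : exists t, 2 ^+ p = 2 + p%:Z ^+ 2 * t.
  move: p_wief; rewrite eqn_mod_dvd ?expn_gt0 // => /dvdnP[v vE].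
  exists (2 * v%:Z); rewrite -(prednK p_gt0) exprS.
  have -> : 2 ^+ p.-1 = (1 + v * p ^ 2)%N%:Z.
    by rewrite -vE subnKC ?expn_gt0 // -natz natrX natz.
  by rewrite prednK // PoszD PoszM -[(p ^ 2)%N%:Z]natz natrX natz; ring.
pose e (i : 'Z_p) : int := (i == 0)%:R + (i == 1)%:R.
pose a (h : 'Z_p * 'Z_p) : int :=
  (h.2 == 0)%:R * e h.1 + wieferich_coef t h.2.
exists a; rewrite group_det_atE; apply: (@intr_inj algC).
have two_neq0 : 2 != 0 :> algC by rewrite Num.Theory.pnatr_eq0.
have [z z_prim] := C_prim_root_exists p_gt0.
rewrite -det_map_mx.
have -> : map_mx intr (group_mx a) = group_mx (fun g => (a g)%:~R : algC).
  by apply/matrixP => i j; rewrite !mxE.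
rewrite (det_group_mx_Zp2 _ p_gt1 z_prim).
pose B (l : 'Z_p) := \sum_(j : 'Z_p) (wieferich_coef t j)%:~R * z ^+ (l * j).
have FE (k l : 'Z_p) :
    \sum_(i : 'Z_p) \sum_(j : 'Z_p) (a (i, j))%:~R * z ^+ (k * i + l * j) =
    1 + z ^+ k + (k == 0)%:R * (p%:R * B l).
  have eE : \sum_(i : 'Z_p) (e i)%:~R * z ^+ (k * i) = 1 + z ^+ k.
    rewrite (bigD1 0) // (bigD1 1) //= big1 => [|i /andP[/negPf i0 /negPf i1]].
      by rewrite /e /= muln0 muln1 !mul1r addr0.
    by rewrite /e i0 i1 mul0r.
  rewrite -eE mulrA -(sum_prim_root_Zp _ p_gt1 z_prim) mulr_suml -big_split /=.
  apply: eq_bigr => i _; rewrite /B mulr_sumr.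
  under eq_bigr => j _ do rewrite /a rmorphD rmorphM /= exprD mulrDl.
  rewrite big_split; congr (_ + _).
    rewrite (bigD1 0) //= big1 => [|j /negPf->]; last by rewrite !mul0r.
    by rewrite muln0 addr0 mul1r mulr1.
  by apply: eq_bigr => j _; rewrite mulrCA mulrA mulrC [(k * i)%N]mulnC; ring.
rewrite (eq_bigr _ (fun k _ => eq_bigr _ (fun l _ => FE k l))).
(* The characters that are nontrivial on [x] contribute 1. *)
rewrite (bigD1 0) //= [X in _ * X](_ : _ = 1) => [|]; last first.
  transitivity (\prod_(k : 'Z_p | k != 0) (1 + z ^+ k) ^+ p).
    apply: eq_bigr => k /negPf->; under eq_bigr do rewrite mul0r addr0.
    by rewrite prodr_const card_ord; congr (_ ^+ _); apply: Zp_cast.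
  by rewrite prodrXl prod1D_prim_root_neq0 // expr1n.
(* Among the others, only the trivial character contributes. *)
under eq_bigr => l _ do rewrite expr0 mul1r sum_wieferich_coef //.
rewrite (bigD1 0) //= mulr1.
rewrite [X in _ * X](_ : _ = 1) => [|]; last first.
  transitivity (\prod_(k : 'Z_p | k != 0) (1 + z ^+ k) ^+ p).
    by apply: eq_bigr => k /negPf->; rewrite mul0r subr0.
  by rewrite prodrXl prod1D_prim_root_neq0 // expr1n.
rewrite expr0 mulr1 mul1r; have := congr1 (intr : int -> algC) tE.
by rewrite rmorphD rmorphXn /= => ->; rewrite addrK.
Qed.

(** * The criterion *)

Lemma Zp2_comm p (x y : (cyclic_group p * cyclic_group p)%type) : commute x y.
Proof. by congr pair; apply: Zp_mulgC. Qed.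

Lemma Zp2_exp p (x : (cyclic_group p * cyclic_group p)%type) :
  (1 < p)%N -> (x ^+ p = 1)%g.
Proof.
move=> p_gt1; have expE n : (x ^+ n)%g = ((x.1 ^+ n)%g, (x.2 ^+ n)%g).
  by elim: n => [|n IH] //; rewrite !expgS IH.
have Zp_exp (i : cyclic_group p) : (i ^+ p)%g = 1%g.
  rewrite Zp_expg; apply: val_inj => /=.
  by rewrite -[X in (_ * X)%N](Zp_cast p_gt1) modnMl.
by rewrite expE !Zp_exp.
Qed.

Theorem corollary2 (p : nat) (p_prime : prime p) :
  wieferich p <->
  int_group_dets (cyclic_group p * cyclic_group p)%type 2.
Proof.
have p_gt1 := prime_gt1 p_prime; split.
  by case/wieferich_two_group_det => a aE; exists a; rewrite aE.
case=> a aE; apply: (wieferich_of_group_det (a := a)) => //.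
- exact: Zp2_comm.
- by move=> x; apply: Zp2_exp.
by rewrite card_prod card_ord Zp_cast // mulnn.
Qed.
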